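(* Let $G_1$ and $G_2$ be two connected graphs, each with $n$ vertices and $m$ edges, having Laplacian spectra $0=\mu_n<\mu_{n-1}\leq\cdots\leq\mu_1$ and $0=\lambda_n<\lambda_{n-1}\leq\cdots\leq\lambda_1$, respectively. Let $p$ be a positive integer such that $$\frac{2m}{p+n}<\min(\mu_{n-1},\lambda_{n-1}).$$ Then $LE(G_1\cup\overline{K_p})=LE(G_2\cup\overline{K_p})$.
   Context: All graphs are finite, undirected and simple. For a graph $G$ with $N$ vertices and $M$ edges, adjacency matrix $A(G)$ and diagonal degree matrix $D(G)$, the Laplacian matrix is $L(G)=D(G)-A(G)$; its eigenvalues with multiplicity, $\mu_1,\dots,\mu_N$, form the Laplacian spectrum of $G$. The Laplacian energy is $LE(G)=\sum_{i=1}^{N}\left|\mu_i-\frac{2M}{N}\right|$. $G\cup H$ denotes the disjoint union of graphs, and $\overline{K_p}$ the graph on $p$ vertices with no edges. Writing $\mu_{n-1}$ presupposes $n\ge 2$. *)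

(* Defs.v *)
From mathcomp Require Import all_boot all_order all_algebra.
From mathcomp Require Import polyrcf.

Set Implicit Arguments.
Unset Strict Implicit.
Unset Printing Implicit Defensive.

Import Order.TTheory GRing.Theory Num.Theory.

Record sgraph := SGraph {
  vertex :> finType;
  adj : rel vertex;
  adj_sym : symmetric adj;
  adj_irrefl : irreflexive adj }.

Definition edges (G : sgraph) : {set {set G}} :=
  [set [set x; y] | x in G, y in G & adj x y].

Definition degree (G : sgraph) (x : G) : nat := #|[set y | adj x y]|.

Definition connected (G : sgraph) : Prop :=
  0 < #|G| /\ forall x y : G, connect (@adj G) x y.

Section Union.
Variables G H : sgraph.

Definition union_adj (u v : G + H) : bool :=
  match u, v with
  | inl x, inl y => adj x y
  | inr x, inr y => adj x y
  | _, _ => false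
  end.

Lemma union_adj_sym : symmetric union_adj.
Proof. by case=> x [] y //=; rewrite adj_sym. Qed.

Lemma union_adj_irrefl : irreflexive union_adj.
Proof. by case=> x /=; rewrite adj_irrefl. Qed.

Definition disjoint_union : sgraph := SGraph union_adj_sym union_adj_irrefl.
End Union.

Definition empty_graph (p : nat) : sgraph :=
  @SGraph 'I_p (fun _ _ => false) (fun _ _ => erefl) (fun _ => erefl).

Local Open Scope ring_scope.

Section Spectra.
Variable R : rcfType.

Definition adjacency_mx (G : sgraph) : 'M[R]_#|G| :=
  \matrix_(i, j) (adj (enum_val i) (enum_val j))%:R.

Definition degree_mx (G : sgraph) : 'M[R]_#|G| :=
  diag_mx (\row_i (degree (enum_val i))%:R).

Definition laplacian_mx (G : sgraph) : 'M[R]_#|G| :=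
  degree_mx G - adjacency_mx G.

(* The eigenvalues of A lying in R, repeated according to their algebraic
   multiplicity and listed in nonincreasing order.  When A is symmetric, e.g. a
   Laplacian matrix, all its eigenvalues lie in the real closed field R, so this
   is the full spectrum of A. *)
Definition spectrum (n : nat) (A : 'M[R]_n) : seq R :=
  let P := char_poly A in
  sort >=%R (flatten [seq nseq (mup x P) x | x <- rootsR P]).

Definition laplacian_spectrum (G : sgraph) : seq R := spectrum (laplacian_mx G).

(* Numbered from 1: the k-th largest eigenvalue, for 1 <= k <= #|G|. *)
Definition laplacian_eigenvalue (G : sgraph) (k : nat) : R :=
  (laplacian_spectrum G)`_k.-1.

Definition laplacian_energy (G : sgraph) : R :=
  \sum_(x <- laplacian_spectrum G) `|x - (2 * #|edges G|)%:R / #|G|%:R|.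
End Spectra.

(* Main.v *)
(** With [c = 2m / (n + p)], the spectrum of [G] together with [p] isolated
    vertices is the spectrum of [G] followed by [p] zeros. Every eigenvalue of
    [G] but the last one, which is [0], exceeds [c], so all absolute values open
    with a known sign, and the energy depends on the spectrum of [G] only
    through its sum, the trace [2m] of the Laplacian: it equals
    [2m + c (p + 2 - n)]. *)

Require Import Defs.
From mathcomp Require Import all_boot all_order all_algebra all_fingroup.
From mathcomp Require Import spectral sesquilinear.
From mathcomp Require Import polyrcf complex.
From mathcomp Require Import ring.

Import Order.TTheory GRing.Theory Num.Theory.

Local Open Scope ring_scope.

(** * Characteristic polynomials and spectra of symmetric matrices *)

Lemma char_poly_similar (F : fieldType) (n : nat) (P A B : 'M[F]_n) :
  P \in unitmx -> P *m A = B *m P -> char_poly A = char_poly B.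
Proof.
move=> Punit PA.
have detP : \det (map_mx polyC P) != 0.
  by rewrite det_map_mx polyC_eq0 -unitfE -unitmxE.
apply: (mulfI detP); rewrite /char_poly -det_mulmx mulrC -det_mulmx.
congr (\det _).
by rewrite mulmxBr mulmxBl -!map_mxM PA mul_mx_scalar mul_scalar_mx.
Qed.

(** Once the sizes are identified, [f] is a permutation and reindexing is conjugation by its matrix.
    The equation [n1 = n2] is a hypothesis because [#|G| + #|H|] and the order of the union are not
    convertible. *)
Lemma char_poly_reindex (F : fieldType) (n1 n2 : nat) (f : 'I_n1 -> 'I_n2)
    (A : 'M[F]_n2) :
  n1 = n2 -> injective f -> char_poly (mxsub f f A) = char_poly A.
Proof.
move=> en; case: n2 / en f A => f A finj.
apply/esym/(@char_poly_similar _ _ (perm_mx (perm finj))) => //.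
  exact: unitmx_perm.
have -> : mxsub f f A = row_perm (perm finj) (col_perm (perm finj) A).
  by apply/matrixP => i j; rewrite !mxE !permE.
by rewrite row_permE col_permE -!mulmxA -perm_mxM mulVg perm_mx1 mulmx1.
Qed.

(** Both lists contain each [x] as often as its multiplicity as a root, so any splitting into linear
    factors determines the spectrum. *)
Lemma perm_spectrum (R : rcfType) (n : nat) (A : 'M[R]_n) (s : seq R) :
  char_poly A = \prod_(x <- s) ('X - x%:P) -> perm_eq (spectrum A) s.
Proof.
move=> Es; rewrite /spectrum perm_sort; apply/allP => x _ /=; apply/eqP.
have P0 : char_poly A != 0 by rewrite monic_neq0 ?char_poly_monic.
rewrite count_flatten -map_comp sumnE big_map -mu_prod_XsubC -Es.
under eq_bigr => y _ do rewrite /= count_nseq /=.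
have memr : (x \in rootsR (char_poly A)) = root (char_poly A) x.
  by rewrite -(roots_on_rootsR P0) in_itv.
have [xr|xNr] := boolP (x \in rootsR (char_poly A)); last first.
  rewrite big_seq big1 => [|y yr]; first by rewrite mupNroot // -memr.
  by case: eqP yr xNr => [->->|].
rewrite (bigD1_seq x) ?uniq_roots //= eqxx mul1n big1 ?addn0 // => y /negPf->.
by rewrite mul0n.
Qed.

(** Over [R[i]] the matrix becomes Hermitian, hence unitarily diagonalizable with real eigenvalues;
    their real parts split the polynomial over [R]. *)
Lemma spectrum_prod_XsubC (R : rcfType) (n : nat) (A : 'M[R]_n) :
  A^T = A -> char_poly A = \prod_(x <- spectrum A) ('X - x%:P).
Proof.
move=> Asym; pose toC := real_complex R.
suff [s Es] : exists s : seq R, char_poly A = \prod_(x <- s) ('X - x%:P).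
  by rewrite Es; apply: perm_big; rewrite perm_sym; apply: perm_spectrum.
have Aherm : map_mx toC A \is hermsymmx.
  apply/is_hermitianmxP; rewrite expr0 scale1r; apply/matrixP => i j.
  rewrite !mxE -[in RHS]Asym mxE /= conj_Creal //.
  by apply/complex_realP; exists (A i j).
have dreal := hermitian_spectral_diag_real Aherm.
have /orthomx_spectralP AE := hermitian_normalmx Aherm.
set P := spectralmx _ in AE; set d := spectral_diag _ in AE dreal.
exists [seq complex.Re (d 0 i) | i : 'I_n].
(* The factorization over [R] may be checked after embedding into complex polynomials. *)
have toCI : injective (map_poly toC) by apply: map_poly_inj.
apply: toCI; rewrite map_char_poly.
rewrite (@char_poly_similar _ _ P _ (diag_mx d)) ?spectral_unit //; last first.
  by rewrite {1}AE !mulmxA mulmxV ?spectral_unit // mul1mx.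
rewrite char_poly_trig ?diag_mx_is_trig // rmorph_prod big_image /=.
apply: eq_bigr => i _; rewrite map_polyXsubC mxE eqxx mulr1n.
congr ('X - _%:P); apply/esym/RRe_real; move/mxOverP: dreal; apply.
Qed.

Lemma size_spectrum (R : rcfType) (n : nat) (A : 'M[R]_n) :
  A^T = A -> size (spectrum A) = n.
Proof.
move=> /spectrum_prod_XsubC /(congr1 (fun p : {poly R} => size p)).
by rewrite size_char_poly size_prod_XsubC => -[].
Qed.

(** Both sides are, up to sign, the subleading coefficient of the characteristic polynomial; size 0,
    which has no such coefficient, is treated apart. *)
Lemma sum_spectrum (R : rcfType) (n : nat) (A : 'M[R]_n) :
  A^T = A -> \sum_(x <- spectrum A) x = \tr A.
Proof.
case: n A => [|n] A Asym.
  by rewrite /mxtrace big_ord0 (size0nil (size_spectrum _ _ _ Asym)) big_nil.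
apply: oppr_inj; rewrite -(char_poly_trace A) // [in RHS]spectrum_prod_XsubC //.
by have := @coefPn_prod_XsubC _ (spectrum A); rewrite size_spectrum // => ->.
Qed.

(** Double counting of arcs: grouped by source they give the degrees, grouped by underlying edge
    they come in pairs. *)
Lemma handshake (G : sgraph) : (\sum_(x : G) degree x = 2 * #|edges G|)%N.
Proof.
pose arcs := [set u : G * G | adj u.1 u.2].
pose edge_of (u : G * G) := [set u.1; u.2].
have edgesE : edges G = [set edge_of u | u in arcs].
  apply/setP => e; apply/imset2P/imsetP.
    move=> [x y _]; rewrite inE /= => xy ->; exists (x, y) => //.
    by rewrite inE.
  move=> [[x y]]; rewrite inE => xy ->; exists x y => //.
  by rewrite inE.
have -> : (\sum_(x : G) degree x = #|arcs|)%N.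
  rewrite -sum1_card.
  rewrite (eq_bigl (fun u : G * G => predT u.1 && adj u.1 u.2)); last first.
    by move=> u; rewrite inE.
  rewrite -(pair_big_dep predT (fun x y => adj x y) (fun _ _ => 1%N)) /=.
  by apply: eq_bigr => x _; rewrite sum1_card /degree cardsE.
rewrite edgesE -sum1_card (partition_big_imset edge_of) /= mulnC -sum_nat_const.
apply: eq_bigr => _ /imsetP [[x y] xy ->]; rewrite inE /= in xy.
have xNy : x != y by apply: contraTneq xy => ->; rewrite adj_irrefl.
(* The fibre over an edge consists of its two orientations, distinct since there are no loops. *)
rewrite sum1_card -(_ : #|[set (x, y); (y, x)]| = 2%N); last first.
  by rewrite cards2 xpair_eqE (negPf xNy).
apply: eq_card => -[a b]; rewrite !inE !xpair_eqE.
rewrite /edge_of /=; apply/andP/orP => [[/[!inE]/= ab /eqP E]|].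
  have aNb : a != b by apply: contraTneq ab => ->; rewrite adj_irrefl.
  have : a \in [set x; y] by rewrite -E !inE eqxx.
  have : b \in [set x; y] by rewrite -E !inE eqxx orbT.
  rewrite !inE => /orP [] /eqP eb /orP [] /eqP ea; rewrite ea eb ?eqxx;
    by [rewrite ea eb eqxx in aNb | left | right].
case=> /andP [/eqP-> /eqP->]; rewrite inE /= ?eqxx //.
by rewrite adj_sym setUC eqxx.
Qed.

(** * Laplacian spectra and the energy with isolated vertices *)

Section Laplacian.
Variable R : rcfType.

Lemma laplacian_sym (G : sgraph) : (laplacian_mx R G)^T = laplacian_mx R G.
Proof.
rewrite /laplacian_mx linearB /= tr_diag_mx; congr (_ - _).
by apply/matrixP => i j; rewrite !mxE adj_sym.
Qed.

Lemma laplacian_trace (G : sgraph) :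
  \tr (laplacian_mx R G) = (2 * #|edges G|)%:R.
Proof.
rewrite -handshake natr_sum (reindex_onto (@enum_val _ G) (@enum_rank _)) /=.
  apply: eq_big => [i|i _]; first by rewrite enum_valK eqxx.
  by rewrite !mxE eqxx adj_irrefl subr0 mulr1n.
by move=> x _; rewrite enum_rankK.
Qed.

(** The all-ones row vector is an eigenvector: each column sums to a degree minus a number of
    neighbours. *)
Lemma laplacian_spectrum0 (G : sgraph) :
  (0 < #|G|)%N -> 0 \in laplacian_spectrum R G.
Proof.
move=> G_gt0; rewrite -root_prod_XsubC -spectrum_prod_XsubC ?laplacian_sym //.
rewrite -eigenvalue_root_char; apply/eigenvalueP.
exists (const_mx 1); last first.
  by apply/rV0Pn; exists (Ordinal G_gt0); rewrite mxE oner_eq0.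
apply/rowP => j; rewrite scale0r !mxE.
under eq_bigr => i _ do rewrite !mxE mul1r.
rewrite sumrB (bigD1 j) //= eqxx mulr1n big1 ?addr0; last first.
  by move=> i /negPf ij; rewrite ij mulr0n.
apply/eqP; rewrite subr_eq0 -natr_sum /degree -sum1_card; apply/eqP; congr _%:R.
rewrite big_mkcond (reindex_onto (@enum_val _ G) (@enum_rank _)) /=.
  apply: eq_big => [i|i _]; first by rewrite enum_valK eqxx.
  by rewrite inE adj_sym; case: adj.
by move=> x _; rewrite enum_rankK.
Qed.

Lemma char_poly_disjoint_union (G H : sgraph) :
  char_poly (laplacian_mx R (disjoint_union G H)) =
  char_poly (laplacian_mx R G) * char_poly (laplacian_mx R H).
Proof.
(* Listing the vertices of [G] before those of [H] makes the Laplacian block diagonal. *)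
pose f (k : 'I_(#|G| + #|H|)) : 'I_#|disjoint_union G H| :=
  enum_rank (match split k with
             | inl i => inl (enum_val i)
             | inr j => inr (enum_val j)
             end : disjoint_union G H).
have finj : injective f.
  move=> k l /enum_rank_inj; case: (split_ordP k) => i ->;
    case: (split_ordP l) => j -> //= [] /enum_val_inj -> //.
rewrite -(@char_poly_reindex _ _ _ f) //; last by rewrite card_sum.
suff -> : mxsub f f (laplacian_mx R (disjoint_union G H)) =
          block_mx (laplacian_mx R G) 0 0 (laplacian_mx R H).
  by rewrite /char_poly char_block_diag_mx det_ublock.
have degl (x : G) : degree (inl x : disjoint_union G H) = degree x.
  rewrite /degree -(card_imset _ (@inl_inj G H)); apply: eq_card => -[y|y];
    rewrite !inE /=.
    by rewrite mem_imset ?inE //; exact: inl_inj.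
  by apply/esym/imsetP => -[].
have degr (x : H) : degree (inr x : disjoint_union G H) = degree x.
  rewrite /degree -(card_imset _ (@inr_inj G H)); apply: eq_card => -[y|y];
    rewrite !inE /=.
    by apply/esym/imsetP => -[].
  by rewrite mem_imset ?inE //; exact: inr_inj.
apply/matrixP => k l; rewrite !mxE /f !enum_rankK (inj_eq enum_rank_inj).
case: (split_ordP k) => i _; rewrite mxE; case: (split_ordP l) => j _;
  rewrite ?mxE ?degl ?degr /= ?subrr //.
  by rewrite (inj_eq (@inl_inj G H)) (inj_eq enum_val_inj).
by rewrite (inj_eq (@inr_inj G H)) (inj_eq enum_val_inj).
Qed.

Lemma perm_laplacian_spectrum_disjoint_union (G H : sgraph) :
  perm_eq (laplacian_spectrum R (disjoint_union G H))
          (laplacian_spectrum R G ++ laplacian_spectrum R H).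
Proof.
apply: perm_spectrum.
rewrite big_cat /= -!spectrum_prod_XsubC ?laplacian_sym //.
exact: char_poly_disjoint_union.
Qed.

Lemma perm_laplacian_spectrum_empty (p : nat) :
  perm_eq (laplacian_spectrum R (empty_graph p)) (nseq p 0).
Proof.
(* The number of zeros is rewritten to match the matrix size, a cardinal rather than [p] itself. *)
apply: perm_spectrum; rewrite -[in nseq p _](card_ord p).
have -> : laplacian_mx R (empty_graph p) = 0.
  apply/matrixP => i j; rewrite !mxE subr0 /degree.
  by rewrite (eq_card0 (A := [set y | _])) ?mul0rn // => x; rewrite inE.
rewrite /char_poly /char_poly_mx map_mx0 subr0 det_scalar.
by rewrite big_nseq subr0 -Monoid.iteropE.
Qed.

(** The [p] isolated vertices contribute [p * c], the eigenvalue 0 of [G] contributes [c], and the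
    other [n - 1] eigenvalues contribute [2m - (n - 1) * c]. *)
Lemma laplacian_energy_isolated (n m p : nat) (G : sgraph) :
  (2 <= n)%N -> #|G| = n -> #|edges G| = m ->
  (2 * m)%:R / (p + n)%:R < laplacian_eigenvalue R G n.-1 ->
  laplacian_energy R (disjoint_union G (empty_graph p)) =
  (2 * m)%:R + (2 * m)%:R / (p + n)%:R * ((p + 2)%:R - n%:R).
Proof.
move=> n2 cG eG; set c := _ / _ => c_lt.
have n_gt0 : (0 < n)%N := ltnW n2.
set U := disjoint_union _ _.
have permU : perm_eq (laplacian_spectrum R U)
                     (laplacian_spectrum R G ++ nseq p 0).
  apply: perm_trans (perm_laplacian_spectrum_disjoint_union _ _) _.
  by rewrite perm_cat2l perm_laplacian_spectrum_empty.
have sumG : \sum_(x <- laplacian_spectrum R G) x = (2 * m)%:R.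
  by rewrite sum_spectrum ?laplacian_sym // laplacian_trace eG.
(* Comparing traces yields the edge count of the union without counting its edges. *)
have eU : (2 * #|edges U|)%:R = (2 * m)%:R :> R.
  rewrite -laplacian_trace -sum_spectrum ?laplacian_sym // (perm_big _ permU).
  by rewrite big_cat /= sumG big_nseq iter_addr_0 mul0rn addr0.
have cU : #|U| = (p + n)%N by rewrite card_sum card_ord cG addnC.
rewrite /laplacian_energy eU cU -/c (perm_big _ permU) big_cat /= big_nseq.
rewrite iter_addr_0 sub0r normrN.
have c_ge0 : 0 <= c by rewrite divr_ge0 ?ler0n.
rewrite ger0_norm //.
have szG : size (laplacian_spectrum R G) = n.
  by rewrite size_spectrum ?laplacian_sym.
have sortG : sorted >=%R (laplacian_spectrum R G).
  by apply: sort_sorted => x y; apply: le_total.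
have G0 : 0 \in laplacian_spectrum R G.
  by apply: laplacian_spectrum0; rewrite cG.
move: c_lt sumG szG sortG G0; rewrite /laplacian_eigenvalue.
(* The smallest eigenvalue [z] is split off; [s] has [n - 1] entries, and the bound concerns its
   last one, at 0-based index [n - 2]. *)
case/lastP: (laplacian_spectrum R G) => [|s z].
  by move=> _ _ /esym n0; rewrite n0 in n_gt0.
rewrite size_rcons => c_lt sumG szG sortG G0.
have s_gt x : x \in s -> c < x.
  move=> xs; apply: lt_le_trans c_lt _.
  have ix : (index x s < size s)%N by rewrite index_mem.
  have -> : x = (rcons s z)`_(index x s) by rewrite nth_rcons ix nth_index.
  apply: (sorted_leq_nth (@ge_trans _ R) (@le_refl _ R) 0 sortG);
    rewrite ?inE ?size_rcons -?szG /=; by case: (size s) ix => // k /leqW.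
(* The eigenvalue 0 cannot lie in [s], whose entries exceed [c >= 0]. *)
have z0 : z = 0.
  move: G0; rewrite mem_rcons inE => /orP [/eqP //|/s_gt].
  by rewrite ltNge c_ge0.
rewrite -cats1 big_cat big_seq1 /= z0 sub0r normrN ger0_norm //.
move: sumG; rewrite -cats1 big_cat big_seq1 z0 /= addr0 => sumG.
rewrite big_seq (eq_bigr (fun x => x - c)) => [|x /s_gt cx]; last first.
  by rewrite ger0_norm // subr_ge0 ltW.
rewrite -big_seq sumrB sumG big_const_seq count_predT iter_addr_0 -szG.
rewrite natrD -[(size s).+1]addn1 natrD -[c *+ p]mulr_natr -[c *+ _]mulr_natr.
ring.
Qed.

End Laplacian.

Theorem theorem3p1 (R : rcfType) (n m p : nat) (G1 G2 : sgraph) :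
  (2 <= n)%N ->
  connected G1 -> connected G2 ->
  #|G1| = n -> #|G2| = n ->
  #|edges G1| = m -> #|edges G2| = m ->
  (0 < p)%N ->
  (2 * m)%:R / (p + n)%:R <
    Num.min (laplacian_eigenvalue R G1 n.-1) (laplacian_eigenvalue R G2 n.-1) ->
  laplacian_energy R (disjoint_union G1 (empty_graph p)) =
  laplacian_energy R (disjoint_union G2 (empty_graph p)).
Proof.
move=> n2 _ _ cG1 cG2 eG1 eG2 _; rewrite lt_min => /andP [lt1 lt2].
(* The closed formula involves only [n], [m] and [p], which both graphs share. *)
rewrite (@laplacian_energy_isolated R n m p G1) //.
by rewrite (@laplacian_energy_isolated R n m p G2).
Qed.
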